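(* Let $K$ be a number field. There is a finite set $S$ such that $\bar{\kappa}(a,K) \geq 6$ for all $a \in K \setminus (S \cap K)$, and $\bar{\kappa}(a,K) = 4$ for all $a \in S \cap K$.
   Context: For $c \in K$ let $f_c(x) = x^2 + c$ and $f_c^N$ its $N$-fold composition. For $a, c \in K$ let $P(a,c) = \{x \in K : f_c^N(x) = a \text{ for some } N \geq 1\}$. Define $\bar{\kappa}(a,K) = \inf_{F \subset K \text{ finite}} \sup_{c \in K \setminus F} \# P(a,c)$. *)

(* Defs.v *)
From HB Require Import structures.
From mathcomp Require Import all_boot all_order all_algebra all_field.
From mathcomp Require Import all_classical all_reals.
From mathcomp Require Import ereal measure.

Set Implicit Arguments.
Unset Strict Implicit.
Unset Printing Implicit Defensive.

Import GRing.Theory.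
Local Open Scope classical_set_scope.
Local Open Scope ring_scope.

Definition quad (K : fieldType) (c x : K) : K := x ^+ 2 + c.

Definition preimages (K : fieldType) (a c : K) : set K :=
  [set x | exists2 N : nat, (1 <= N)%N & iter N (quad c) x = a].

(* Cardinalities, suprema and infima are extended reals: [counting A] is the
   number of elements of [A] when [A] is finite and [+oo] otherwise. The real
   field [R] only serves to form [\bar R]. *)
Definition kappa_bar (R : realType) (K : fieldType) (a : K) : \bar R :=
  ereal_inf
    [set ereal_sup [set counting (preimages a c) | c in ~` F]
      | F in [set F : set K | finite_set F]].

(* Main.v *)
(** The exceptional set can be taken empty: [kappa_bar a >= 6] for every [a].
    If [r ^+ 2 = a - c], [s ^+ 2 = r - c] and [t ^+ 2 = s - c], then [+-r], [+-s]
    and [+-t] are preimages of [a], and for fixed [a] such triples are the points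
    of a curve of genus one, with Weierstrass equation
    [n ^+ 2 = b ^+ 2 + (X + b - 1) * (X ^+ 2 - 1)] where [b = 4 * a + 1].

    This curve has infinitely many points. Fix a valuation ring of [K] in which
    2 is not invertible, with absolute value [|.|]. If [|X| > max(1, |b|)], the
    duplication formula gives [|X(2P)| = |X(P) / 4| > |X(P)|], so repeated
    doubling produces pairwise distinct points. Such a starting point always
    exists: [X = b ^+ 2 / 4], the abscissa of the double of [(1 - b, b)], if
    [|b| >= 1]; and, if [|b| < 1], the abscissa [((b ^+ 2 + 2 * b - 1) / 2) ^+ 2
    + b + 1] of the quadruple of [(1, b)], which has absolute value [|1 / 4|].
    No smoothness is needed, so degenerate fibres require no separate treatment. *)

Require Import Defs.
From HB Require Import structures.
From mathcomp Require Import all_boot all_order all_algebra all_field.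
From mathcomp Require Import all_classical all_reals.
From mathcomp Require Import ereal measure.
From mathcomp Require Import ring zify.

Set Implicit Arguments.
Unset Strict Implicit.
Unset Printing Implicit Defensive.

Import GRing.Theory.

(** * Duplication on the cubic [n ^+ 2 = cubic b X] *)

Section Curve.
Local Open Scope ring_scope.
Variable K : fieldType.
Implicit Types (a b X n : K).

Definition cubic b X := b ^+ 2 + (X + b - 1) * (X ^+ 2 - 1).

Definition double_abscissa b X :=
  (X ^+ 4 + 2 * X ^+ 2 - 8 * (b ^+ 2 - b + 1) * X
     + (1 - 4 * (b - 1) * (b ^+ 2 - b + 1))) / (4 * cubic b X).

(** The tangent at [(X, n)] has slope [l], the derivative [d] of the cubic over [2 * n]. It meets
    the curve again at abscissa [l ^+ 2 - (b - 1) - 2 * X], where its ordinate is the required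
    [n']. *)
Lemma cubic_double b X n : 2 != 0 :> K -> n != 0 -> n ^+ 2 = cubic b X ->
  exists n', n' ^+ 2 = cubic b (double_abscissa b X).
Proof.
move=> two0 n0 Dn.
pose d := 3 * X ^+ 2 + 2 * (b - 1) * X - 1.
pose l := d / (2 * n).
have Dl : d = 2 * n * l by rewrite /l mulrC divfK // mulf_neq0.
have -> : double_abscissa b X = l ^+ 2 - (b - 1) - 2 * X.
  have four0 : 4 != 0 :> K by rewrite (natrM _ 2 2) mulf_neq0.
  have g0 : cubic b X != 0 by rewrite -Dn expf_neq0.
  have -> : l ^+ 2 = d ^+ 2 / (4 * cubic b X).
    by rewrite -Dn /l; field; rewrite n0 four0.
  rewrite /double_abscissa [X in X / _](_ : _ =
    d ^+ 2 - 4 * cubic b X * (b - 1 + 2 * X)); last by rewrite /cubic /d; ring.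
  by field; rewrite g0 four0.
set X' := l ^+ 2 - _ - _.
exists (n + l * (X' - X)).
(* Taylor expansion at [X] of the cubic minus the square of the tangent line *)
have DX' : X' + 2 * X + (b - 1) - l ^+ 2 = 0 by rewrite /X'; ring.
have : cubic b X' - (n + l * (X' - X)) ^+ 2 =
    (cubic b X - n ^+ 2) + (d - 2 * n * l) * (X' - X)
    + (X' - X) ^+ 2 * (X' + 2 * X + (b - 1) - l ^+ 2).
  by rewrite /cubic /d; ring.
by rewrite Dn subrr -Dl subrr mul0r DX' mulr0 !addr0 => /subr0_eq.
Qed.
End Curve.

(** * Valuation rings as maximal subrings avoiding 1/2 *)

Section ValuationRing.
Local Open Scope classical_set_scope.
Local Open Scope ring_scope.
Variable K : fieldType.
Implicit Types (A : set K) (x y : K) (p q : {poly K}).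

Record is_subring A : Prop := IsSubring {
  subring1 : A 1;
  subringB : forall x y, A x -> A y -> A (x - y);
  subringM : forall x y, A x -> A y -> A (x * y) }.

Section SubringTheory.
Variable A : set K.
Hypothesis subA : is_subring A.

Lemma subring0 : A 0.
Proof. by rewrite -(subrr 1); apply: subringB => //; exact: subring1. Qed.

Lemma subringN x : A x -> A (- x).
Proof. by move=> Ax; rewrite -sub0r; apply: subringB => //; exact: subring0. Qed.

Lemma subringD x y : A x -> A y -> A (x + y).
Proof.
by move=> Ax Ay; rewrite -(opprK y); apply: subringB => //; exact: subringN.
Qed.

Lemma subring_nat n : A n%:R.
Proof.
elim: n => [|n IHn]; first exact: subring0.
by rewrite -addn1 natrD; apply: subringD => //; exact: subring1.
Qed.

Lemma subring_sum n (F : 'I_n -> K) : (forall i, A (F i)) -> A (\sum_i F i).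
Proof.
by move=> AF; apply: big_ind => //; [exact: subring0|exact: subringD].
Qed.

Lemma subringX x n : A x -> A (x ^+ n).
Proof.
move=> Ax; elim: n => [|n IHn]; first by rewrite expr0; exact: subring1.
by rewrite exprS; apply: subringM.
Qed.

Definition coefs_in p := forall i, A p`_i.

Definition adjoin x : set K := [set p.[x] | p in coefs_in].

Lemma adjoin_subring x : is_subring (adjoin x).
Proof.
split.
- exists 1; last by rewrite hornerC.
  by move=> i; rewrite coef1; exact: subring_nat.
- move=> _ _ [p Ap <-] [q Aq <-]; exists (p - q); last by rewrite hornerD hornerN.
  by move=> i; rewrite coefB; apply: subringB.
- move=> _ _ [p Ap <-] [q Aq <-]; exists (p * q); last by rewrite hornerM.
  by move=> i; rewrite coefM; apply: subring_sum => j; apply: subringM.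
Qed.

Lemma sub_adjoin x : A `<=` adjoin x.
Proof.
move=> y Ay; exists y%:P; last by rewrite hornerC.
by move=> i; rewrite coefC; case: ifP => // _; exact: subring0.
Qed.

Lemma mem_adjoin x : adjoin x x.
Proof.
exists 'X; last by rewrite hornerX.
by move=> i; rewrite coefX; exact: subring_nat.
Qed.

Hypothesis half_notin : ~ A 2^-1.
Hypothesis maxA : forall B, is_subring B -> ~ B 2^-1 -> A `<=` B -> B `<=` A.

Lemma half_in_adjoin x : ~ A x -> adjoin x 2^-1.
Proof.
move=> nAx; apply: contrapT => nBh; apply: nAx.
exact: (maxA (adjoin_subring x) nBh (@sub_adjoin x)) (mem_adjoin x).
Qed.

Lemma two_neq0 : 2 != 0 :> K.
Proof.
by apply/eqP => two0; apply: half_notin; rewrite two0 invr0; exact: subring0.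
Qed.

(** Puts 2 in the Jacobson radical of [A]; the dichotomy below has to divide by such a unit. *)
Lemma inv_1Bdouble x : A x -> A (1 - 2 * x)^-1.
Proof.
move=> Ax; set u := 1 - 2 * x; apply: contrapT => nAu.
have Au : A u.
  by apply: subringB; [|exact: subring1|apply: subringM => //; exact: subring_nat].
have u0 : u != 0.
  by apply/eqP => u0; apply: nAu; rewrite u0 invr0; exact: subring0.
have [p Ap hp] := half_in_adjoin nAu.
(* Clearing denominators, a power of [u] lies in [2 A]; but it is [1] mod [2 A]. *)
have [y Ay Ey] : exists2 y, A y & u ^+ (size p) = 2 * y.
  exists (\sum_(i < size p) p`_i * u ^+ (size p - i)).
    by apply: subring_sum => i; apply: subringM => //; exact: subringX.
  rewrite -[LHS](mulVKf two_neq0) -hp horner_coef mulr_suml.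
  congr (2 * _); apply: eq_bigr => i _.
  rewrite -mulrA; congr (_ * _).
  by rewrite expfB // exprVn mulrC.
have [z Az Ez] : exists2 z, A z & u ^+ (size p) = 1 - 2 * z.
  elim: (size p) => [|n [z Az Ez]].
    by exists 0; [exact: subring0|rewrite expr0 mulr0 subr0].
  exists (z + x - 2 * x * z); last by rewrite exprS Ez /u; ring.
  apply: subringB => //; first exact: subringD.
  by apply: subringM => //; apply: subringM => //; exact: subring_nat.
apply: half_notin; suff -> : 2^-1 = y + z by exact: subringD.
apply: (mulfI two_neq0); rewrite mulfV ?two_neq0 //.
by rewrite mulrDr -Ey Ez subrK.
Qed.


(** If both fail, 1/2 is a polynomial [p] in [x] and a polynomial [q] in [x^-1] over [A]. Up to
    exchanging [x] and [x^-1], [p] is the longer one; [q] serves to shorten it, a descent on the sum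
    of the sizes. *)
Lemma maximal_dichotomy x : A x \/ A x^-1.
Proof.
apply: contrapT => /not_orP[nAx nAx'].
have [p Ap hp] := half_in_adjoin nAx.
have [q Aq hq] := half_in_adjoin nAx'.
move: {2}(size p + size q)%N (leqnn (size p + size q)) => k.
elim: k => [|k IHk] in x p q nAx nAx' Ap hp Aq hq *.
  rewrite leqn0 addn_eq0 size_poly_eq0 => /andP[/eqP p0 _].
  by move: hp two_neq0; rewrite p0 horner0 => /eqP; rewrite eq_sym invr_eq0 => ->.
move=> szpq.
wlog szqp : x p q nAx nAx' Ap hp Aq hq szpq / (size q <= size p)%N => [wlog_hyp|].
  have [|/ltnW] := leqP (size q) (size p); first exact: wlog_hyp hq szpq.
  by apply: (wlog_hyp x^-1 q p) => //; rewrite ?invrK // addnC.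
have x0 : x != 0 by apply/eqP => x0; apply: nAx; rewrite x0; exact: subring0.
have [n szp] : exists n, size p = n.+2.
  case: (leqP (size p) 1) => [/size1_polyC pC|]; last first.
    by case: (size p) => [|[|n]] // _; exists n.
  by case: half_notin; rewrite -hp pC hornerC; exact: Ap.
pose u := 1 - 2 * q`_0.
have Au : A u^-1 by exact: inv_1Bdouble.
have u0 : u != 0.
  apply/eqP; rewrite /u => /eqP; rewrite subr_eq0 => /eqP E; apply: half_notin.
  suff -> : 2^-1 = q`_0 by exact: Aq.
  by apply: (mulfI two_neq0); rewrite -E mulfV ?two_neq0.
(* [x ^+ n.+1] times the relation [u = 2 * (q - q`_0).[x^-1]] lets one replace
   the leading term of [p] by terms of lower degree. *)
have relx : 2 * (\sum_(i < n.+1) q`_(n.+1 - i) * x ^+ i) = u * x ^+ n.+1.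
  have -> : u = 2 * (\sum_(i < n.+1) q`_i.+1 * x^-1 ^+ i.+1).
    apply/eqP; rewrite subr_eq -mulrDr -(inj_eq (mulfI (invr_neq0 two_neq0))).
    rewrite mulr1 mulKf ?two_neq0 // -hq.
    rewrite (@horner_coef_wide _ n.+2 q) -1?szp // szp [eqbLHS]big_ord_recl.
    rewrite expr0 mulr1 addrC; apply/eqP; congr (_ + _).
  rewrite -mulrA mulr_suml; congr (2 * _).
  rewrite (reindex_inj rev_ord_inj) /=; apply: eq_bigr => i _.
  rewrite subKn ?ltn_ord // expfB_cond ?(negPf x0) ?ltn_ord //.
  by rewrite exprVn -mulrA [x ^+ _ / _]mulrC.
pose p' := \poly_(i < n.+1) (p`_i + 2 * p`_n.+1 * q`_(n.+1 - i) / u).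
apply: (IHk x p' q) => //.
- move=> i; rewrite coef_poly; case: ifP => _; last exact: subring0.
  apply: subringD => //; apply: subringM => //; apply: subringM => //.
  by apply: subringM => //; exact: subring_nat.
- rewrite -hp horner_poly horner_coef szp [RHS]big_ord_recr /=.
  have -> : p`_n.+1 * x ^+ n.+1 = p`_n.+1 / u * (u * x ^+ n.+1).
    by rewrite -mulrA mulKf.
  rewrite -relx 2!mulr_sumr -big_split /=; apply: eq_bigr => i _.
  by ring.
- rewrite -ltnS (leq_trans _ szpq) // -addSn leq_add2r szp ltnS.
  exact: size_poly.
Qed.
End SubringTheory.

Definition int_image : set K := [set n%:~R | n in [set: int]].

Lemma int_image_subring : is_subring int_image.
Proof.
split; first by exists 1.
- by move=> _ _ [m _ <-] [n _ <-]; exists (m - n) => //; rewrite intrB.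
- by move=> _ _ [m _ <-] [n _ <-]; exists (m * n) => //; rewrite intrM.
Qed.

Lemma half_notin_int : [pchar K] =i pred0 -> ~ int_image 2^-1.
Proof.
move=> charK [n _ /= Dn].
have nat0 := (pcharf0P K).1 charK.
have two0 : 2 != 0 :> K by rewrite nat0.
have : (absz (n * 2 - 1)%R)%:R == 0 :> K.
  have /eqP: (n * 2 - 1)%:~R = 0 :> K by rewrite intrB intrM Dn mulVf ?subrr.
  by case: (n * 2 - 1) => k //; rewrite NegzE mulrNz oppr_eq0.
by rewrite nat0 absz_eq0 subr_eq0 => /eqP; case: n {Dn} => n; lia.
Qed.

(** Zorn's lemma gives a subring maximal among those avoiding 1/2, to which [maximal_dichotomy]
    applies. *)
Lemma dyadic_valuation_ring_exists : [pchar K] =i pred0 ->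
  exists O : set K, [/\ is_subring O, ~ O 2^-1 & forall x, O x \/ O x^-1].
Proof.
move=> charK.
(* The empty set is allowed so that the empty chain has an upper bound. *)
pose P A := (A !=set0 -> is_subring A) /\ ~ A 2^-1.
have [|O [[subO nO] maxO]] := @Zorn_bigcup K P.
  move=> F FP totF; split; last by move=> [A FA]; have [] := FP _ FA.
  move=> [x [A FA Ax]].
  have subF B y : F B -> B y -> is_subring B.
    by move=> FB By; have [+ _] := FP _ FB; apply; exists y.
  have joinF y z : (\bigcup_(X in F) X) y -> (\bigcup_(X in F) X) z ->
      exists B, [/\ F B, B y & B z].
    move=> [B FB By] [C FC Cz]; have [BC|CB] := totF _ _ FB FC.
      by exists C; split=> //; exact: BC.
    by exists B; split=> //; exact: CB.
  split; first by exists A => //; exact: subring1 (subF _ _ FA Ax).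
  - move=> y z Fy Fz; have [B [FB By Bz]] := joinF _ _ Fy Fz.
    by exists B => //; apply: (subringB (subF _ _ FB By)).
  - move=> y z Fy Fz; have [B [FB By Bz]] := joinF _ _ Fy Fz.
    by exists B => //; apply: (subringM (subF _ _ FB By)).
have {}maxO B : is_subring B -> ~ B 2^-1 -> O `<=` B -> B `<=` O.
  move=> subB nB OB; apply: contrapT => nBO.
  by apply: (maxO B); [split|split].
(* The maximal element is not empty, since the image of the integers would be strictly larger. *)
have {}subO : is_subring O.
  apply: subO; apply: contrapT => /set0P/negP/negPn/eqP O0.
  have := maxO _ int_image_subring (half_notin_int charK).
  rewrite O0 => /(_ (@sub0set _ _) 1); apply; exact: subring1 int_image_subring.
exists O; split=> // x; exact: maximal_dichotomy.
Qed.

(** * Infinitely many points by repeated doubling *)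

Section Valuation.
Variable O : set K.
Hypotheses (subO : is_subring O) (dichO : forall x, O x \/ O x^-1).

(** The guard [x != 0] keeps 0 in the ideal: [0^-1] is 0, which lies in [O]. *)
Definition maximal_ideal : set K := [set x | O x /\ (x != 0 -> ~ O x^-1)].
Local Notation m := maximal_ideal.

Lemma maxideal_sub x : m x -> O x. Proof. by case. Qed.

Lemma maxideal0 : m 0.
Proof. by split; [exact: subring0|rewrite eqxx]. Qed.

Lemma maxidealM x y : m x -> O y -> m (x * y).
Proof.
move=> [Ox nOx] Oy; split; first exact: subringM.
rewrite mulf_eq0 negb_or => /andP[x0 y0] Oxy; apply: (nOx x0).
have -> : x^-1 = y * (x * y)^-1 by rewrite invfM mulrCA mulfV ?mulr1.
exact: subringM.
Qed.

Lemma maxidealN x : m x -> m (- x).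
Proof.
move=> mx; rewrite -mulrN1; apply: maxidealM => //.
exact: subringN subO _ (subring1 subO).
Qed.

Lemma maxidealD x y : m x -> m y -> m (x + y).
Proof.
have [->|x0] := eqVneq x 0; first by rewrite add0r.
have [->|y0] := eqVneq y 0; first by rewrite addr0.
wlog Oyx : x y x0 y0 / O (y / x) => [wlog_hyp|] mx my.
  have [Oyx|] := dichO (y / x); first exact: wlog_hyp.
  by rewrite invf_div addrC => Oxy; exact: wlog_hyp.
have -> : x + y = x * (1 + y / x) by rewrite mulrDr mulr1 mulrCA mulfV ?mulr1.
by apply: maxidealM => //; apply: subringD => //; exact: subring1.
Qed.

Lemma notin_ring_maxideal x : ~ O x^-1 -> m x.
Proof. by move=> nOx; have [Ox|//] := dichO x; split. Qed.

Lemma one_notin_maxideal : ~ m 1.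
Proof. by move=> [_]; rewrite invr1 oner_eq0; apply=> //; exact: subring1. Qed.

Lemma unit_1D x : m x -> 1 + x != 0 /\ O (1 + x)^-1.
Proof.
move=> mx; split.
  apply/eqP => x1; apply: one_notin_maxideal.
  by rewrite -(addrK x 1) x1 sub0r; exact: maxidealN.
apply: contrapT => /notin_ring_maxideal m1x; apply: one_notin_maxideal.
by rewrite -(addrK x 1); apply: maxidealD => //; exact: maxidealN.
Qed.

(* [X > max(1, |b|)] for the absolute value attached to [O] *)
Definition escaping (b X : K) := [/\ X != 0, m X^-1 & m (b / X)].

Hypothesis nO : ~ O 2^-1.

Lemma maxideal2 : m 2. Proof. exact: notin_ring_maxideal. Qed.

Lemma dyadic_two_neq0 : 2 != 0 :> K.
Proof. exact: two_neq0 subO nO. Qed.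

Lemma maxideal4 : m 4.
Proof.
have -> : 4 = 2 * 2 :> K by ring.
by apply: maxidealM; [exact: maxideal2|exact: maxideal_sub maxideal2].
Qed.

Ltac in_ring :=
  repeat first [ assumption | exact: subring_nat | exact: subring1 | exact: subring0
    | apply: subringX => // | apply: subringN => //
    | apply: subringD => // | apply: subringM => // ].

(** In terms of [z = X^-1] and [e = b / X], the cubic is [X ^+ 3 * (1 + d1)] and the numerator of
    the duplication formula is [X ^+ 4 * (1 + d2)], with [d1] and [d2] in [m]. Hence doubling
    divides [X] by [q], which is 4 times a unit. *)
Lemma escaping_double b X n : escaping b X -> n ^+ 2 = cubic b X ->
  exists X', [/\ escaping b X', m (X / X') & exists n', n' ^+ 2 = cubic b X'].
Proof.
move=> [X0 mz me] Dn.
have two0 := dyadic_two_neq0.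
have four0 : 4 != 0 :> K by rewrite (natrM _ 2 2) mulf_neq0.
set z := X^-1 in mz; set e := b / X in me.
have [Oz Oe] := (maxideal_sub mz, maxideal_sub me).
(* [h] is [(b ^+ 2 - b + 1) / X ^+ 2]. *)
pose h := e ^+ 2 - e * z + z ^+ 2.
have Oh : O h by rewrite /h; in_ring.
pose d1 := e + z * (e ^+ 2 - 1 - z * (1 + e - z)).
pose d2 := z * (2 * z - 8 * h + z ^+ 3 - 4 * (e - z) * h).
have md1 : m d1.
  by apply: maxidealD => //; apply: maxidealM => //; in_ring.
have md2 : m d2 by apply: maxidealM => //; in_ring.
have [d1n0 _] := unit_1D md1.
have [d2n0 Ou2] := unit_1D md2.
have z0 : z != 0 by rewrite invr_neq0.
have DX : X = z^-1 by rewrite invrK.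
have Db : b = e / z by rewrite -DX /e divfK.
have Dg : cubic b X = X ^+ 3 * (1 + d1).
  by rewrite /cubic /d1 Db DX; field.
have n0 : n != 0.
  by rewrite -sqrf_eq0 Dn Dg mulf_neq0 // expf_neq0.
have [n' Dn'] := cubic_double two0 n0 Dn.
pose q := 4 * (1 + d1) / (1 + d2).
have mq : m q.
  apply: maxidealM Ou2; apply: maxidealM maxideal4 _.
  by apply: subringD (subring1 _) (maxideal_sub md1).
have DX' : double_abscissa b X = X / q.
  rewrite /double_abscissa Dg /q invf_div mulrA.
  rewrite [X in X / _](_ : _ = X ^+ 4 * (1 + d2)).
    by field; rewrite d1n0 four0.
  by rewrite /d2 /h Db DX; field.
have q0 : q != 0 by rewrite !mulf_neq0 // invr_neq0.
exists (X / q); split; last by exists n'; rewrite Dn' DX'.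
  split; first by rewrite mulf_neq0 // invr_neq0.
    by rewrite invf_div mulrC; apply: maxidealM mz (maxideal_sub mq).
  by rewrite invf_div mulrCA mulrC; apply: maxidealM me (maxideal_sub mq).
by rewrite invf_div mulrCA mulfV // mulr1.
Qed.

Lemma escaping_point b : exists2 X, escaping b X & exists n, n ^+ 2 = cubic b X.
Proof.
have two0 := dyadic_two_neq0.
have four0 : 4 != 0 :> K by rewrite (natrM _ 2 2) mulf_neq0.
have [[b0 Ob']|nb] := pselect (b != 0 /\ O b^-1).
  exists (b ^+ 2 / 4).
    split; first by rewrite mulf_neq0 ?expf_neq0 ?invr_neq0.
      rewrite invf_div; apply: maxidealM maxideal4 _.
      by rewrite -exprVn; apply: subringX.
    have -> : b / (b ^+ 2 / 4) = 4 / b by field; rewrite b0 four0.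
    exact: maxidealM maxideal4 _.
  exists ((b ^+ 3 + 2 * b ^+ 2 - 4 * b + 8) / 8).
  have eight0 : 8 != 0 :> K by rewrite (natrM _ 2 4) mulf_neq0.
  by rewrite /cubic; field; rewrite eight0 four0.
have mb : m b.
  have [Ob|Ob'] := dichO b.
    by split=> // b0 Ob'; apply: nb.
  have [->|b0] := eqVneq b 0; first exact: maxideal0.
  by case: nb.
have Ob := maxideal_sub mb.
(* The tangent slope at the point [(-b, 1)] of the curve. *)
pose l := (b ^+ 2 + 2 * b - 1) / 2.
pose d := b * ((b + 2) * (b ^+ 2 + 2 * b - 2) + 4) + 4.
have md : m d.
  apply: maxidealD maxideal4; apply: maxidealM => //.
  by in_ring.
have [d0 Od] := unit_1D md.
have DX : l ^+ 2 + b + 1 = (1 + d) / 4 by rewrite /l /d; field; rewrite four0.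
have mX : m (l ^+ 2 + b + 1)^-1.
  by rewrite DX invf_div; exact: maxidealM maxideal4 Od.
exists (l ^+ 2 + b + 1).
  split=> //; first by rewrite DX mulf_neq0 ?invr_neq0.
  by apply: maxidealM => //; exact: maxideal_sub mX.
exists (1 + l * (l ^+ 2 + 2 * b + 1)).
by rewrite /cubic /l; field; rewrite two0.
Qed.

(** Along the orbit of doublings, every earlier abscissa divided by a later one lies in [m], which
    does not contain 1; so no value repeats. *)
Lemma infinite_abscissas b :
  infinite_set [set X : K | exists n, n ^+ 2 = cubic b X].
Proof.
pose P X := escaping b X /\ exists n, n ^+ 2 = cubic b X.
have /choice[f Hf] : forall X, exists X' : K, P X -> P X' /\ m (X / X').
  move=> X; have [[eX [n Dn]]|] := pselect (P X); last by exists X.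
  by have [X' [eX' mX' hn']] := escaping_double eX Dn; exists X'.
have [X0 eX0 hX0] := escaping_point b.
pose u k := iter k f X0.
have Pu k : P (u k) by elim: k => [|k /Hf[]].
have mu k j : m (u k / u (k + j.+1)%N).
  have [_ mf] := Hf _ (Pu (k + j)%N).
  rewrite addnS; elim: j mf => [|j IHj] mf; first by rewrite addn0 in mf *.
  have [_ mf'] := Hf _ (Pu (k + j)%N).
  have [[uj0 _ _] _] := Pu (k + j.+1)%N.
  have -> : u k / u (k + j.+1).+1%N
            = u k / u (k + j.+1)%N * (u (k + j.+1)%N / u (k + j.+1).+1%N).
    by rewrite mulrA divfK.
  apply: maxidealM (maxideal_sub mf); rewrite addnS; exact: IHj.
have u_inj : injective u.
  have ult i j : (i < j)%N -> u i <> u j.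
    move=> ltij E; apply: one_notin_maxideal.
    have := mu i (j - i.+1)%N; rewrite addnS -addSn subnKC // E mulfV //.
    by have [[]] := Pu j.
  by move=> i j E; case: (ltngtP i j) => // /ult; rewrite E.
move=> /(finite_preimage (in2W u_inj)); apply: sub_infinite_set infinite_nat.
by move=> k _; have [_] := Pu k.
Qed.
End Valuation.
End ValuationRing.

(** * From points of the cubic to chains [t], [s], [r] of preimages *)

Section Preimages.
Local Open Scope classical_set_scope.
Local Open Scope ring_scope.
Variable K : fieldType.
Hypothesis charK : [pchar K] =i pred0.
Implicit Types (a b c r s t u w X n : K) (F : set K).

Lemma infinite_cubic_abscissas b :
  infinite_set [set X : K | exists n, n ^+ 2 = cubic b X].
Proof.
have [O [subO nO dichO]] := dyadic_valuation_ring_exists charK.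
exact: infinite_abscissas subO dichO nO b.
Qed.

Lemma pchar0_two_neq0 : 2 != 0 :> K.
Proof. by have [/(_ charK) -> _] := pcharf0P K. Qed.

(** The derivative in [s] of the quadratic in [Q0] below; at a root its square is the
    discriminant. *)
Definition discriminant_root u s :=
  8 * u * (u - 1) * s + (1 - 2 * u) * (1 - 2 * u ^+ 2).

Definition abscissa s t :=
  2 * (t - s) ^+ 2 - discriminant_root (t - s) s.

(* With [u = t - s], the two equations amount to [r = s * (1 - 2 * u) - u ^+ 2]
   and a quadratic equation in [s] whose discriminant is a quartic in [u];
   writing the square root of the latter as [2 * u ^+ 2 - X] turns the quartic
   into a quadratic in [u], whose discriminant is the cubic in [X]. *)
Lemma cubic_point_preimages a X n : n ^+ 2 = cubic (4 * a + 1) X ->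
  X != - (4 * a) -> X ^+ 2 != 1 -> (2 - X) ^+ 2 != 1 ->
  exists r s t, [/\ s ^+ 2 = r ^+ 2 + r - a, t ^+ 2 = r ^+ 2 + s - a &
    X = abscissa s t].
Proof.
move=> Dn XN X1 X3; have two0 := pchar0_two_neq0.
have four0 : 4 != 0 :> K by rewrite (natrM _ 2 2) mulf_neq0.
have eight0 : 8 != 0 :> K by rewrite (natrM _ 2 4) mulf_neq0.
have sixteen0 : 16 != 0 :> K by rewrite (natrM _ 2 8) mulf_neq0.
pose b := 4 * a + 1.
have d0 : X + 4 * a != 0 by rewrite addr_eq0.
(* A root of [4 * (X + 4 * a) * u ^+ 2 - 4 * b * u + 1 - X ^+ 2]. *)
pose u := (b - n) / (2 * (X + 4 * a)).
pose w := 2 * u ^+ 2 - X.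
have Dw : w ^+ 2 = 4 * u ^+ 4 + 16 * a * u ^+ 2 - 4 * b * u + 1.
  apply/eqP; rewrite -subr_eq0; apply/eqP.
  have -> : w ^+ 2 - (4 * u ^+ 4 + 16 * a * u ^+ 2 - 4 * b * u + 1) =
      (cubic b X - n ^+ 2) / (X + 4 * a).
    by rewrite /w /u /cubic /b; field; rewrite d0 two0.
  by rewrite Dn subrr mul0r.
(* [u] must avoid 0 and 1 for the equation in [s] to be truly quadratic. *)
have u0 : u != 0.
  apply: contra X1 => /eqP u0; apply/eqP; move: Dw; rewrite /w u0 => Dw.
  by transitivity ((2 * 0 ^+ 2 - X) ^+ 2); [ring|rewrite Dw; ring].
have u1 : u - 1 != 0.
  rewrite subr_eq0; apply: contra X3 => /eqP u1; apply/eqP.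
  move: Dw; rewrite /w u1 => Dw.
  by transitivity ((2 * 1 ^+ 2 - X) ^+ 2); [ring|rewrite Dw /b; ring].
pose s := (w - (1 - 2 * u) * (1 - 2 * u ^+ 2)) / (8 * u * (u - 1)).
have Ds : discriminant_root u s = w.
  by rewrite /discriminant_root /s; field; rewrite u1 u0 eight0.
have Q0 : 4 * u * (u - 1) * s ^+ 2 + (1 - 2 * u) * (1 - 2 * u ^+ 2) * s
    + u ^+ 4 - u ^+ 2 - a = 0.
  apply: (@mulfI _ (16 * u * (u - 1))).
    by apply: mulf_neq0 => //; apply: mulf_neq0.
  transitivity (discriminant_root u s ^+ 2
    - (4 * u ^+ 4 + 16 * a * u ^+ 2 - 4 * b * u + 1)).
    by rewrite /discriminant_root /b; ring.
  by rewrite Ds Dw subrr mulr0.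
exists (s * (1 - 2 * u) - u ^+ 2), s, (s + u).
have Es : s ^+ 2 = (s * (1 - 2 * u) - u ^+ 2) ^+ 2
    + (s * (1 - 2 * u) - u ^+ 2) - a.
  by apply/esym/eqP; rewrite -subr_eq0; apply/eqP; rewrite -[RHS]Q0; ring.
split=> //.
  transitivity (s ^+ 2 - (s * (1 - 2 * u) - u ^+ 2) + s); first by ring.
  by rewrite {1}Es; ring.
by rewrite /abscissa [s + u]addrC addrK Ds /w; ring.
Qed.

Lemma finite_root (p : {poly K}) : p != 0 -> finite_set [set x | root p x].
Proof.
move=> p0; apply: contrapT => /(infinite_set_fset (size p))[B Bp].
rewrite leqNgt => /negP; apply; apply: max_poly_roots (finmap.fset_uniq B) => //.
by apply/allP => x xB; exact: Bp.
Qed.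

Lemma finite_sqr_preimage F : finite_set F -> finite_set [set x | F (x ^+ 2)].
Proof.
move=> finF; apply: (@sub_finite_set _ _
  (\bigcup_(y in F) [set x | root ('X^2 - y%:P) x])).
  by move=> x Fx; exists (x ^+ 2) => //=; rewrite rootE !hornerE subrr.
by apply: bigcup_finite => // y _; apply/finite_root/monic_neq0/monicXnsubC.
Qed.

(** With [c = a - r ^+ 2], each of [c], [r], [s] leaves finitely many choices for the next of [r],
    [s], [t], and [X] is a function of [s] and [t]. So infinitely many abscissas give values of [c]
    outside any finite set. *)
Lemma finite_abscissas a F : finite_set F ->
  finite_set [set X | exists r s t, [/\ F (a - r ^+ 2),
    s ^+ 2 = r ^+ 2 + r - a, t ^+ 2 = r ^+ 2 + s - a & X = abscissa s t]].
Proof.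
move=> finF.
pose R := [set r | [set a - c | c in F] (r ^+ 2)].
pose S := [set s | [set r ^+ 2 + r - a | r in R] (s ^+ 2)].
pose T := [set t | [set r ^+ 2 + s - a | r in R & s in S] (t ^+ 2)].
have finR : finite_set R by exact/finite_sqr_preimage/finite_image.
have finS : finite_set S by exact/finite_sqr_preimage/finite_image.
have finT : finite_set T by exact/finite_sqr_preimage/finite_image2.
apply: sub_finite_set (finite_image2 abscissa finS finT).
move=> X [r [s [t [Fr Ds Dt ->]]]].
have Rr : R r by exists (a - r ^+ 2) => //; rewrite subKr.
have Ss : S s by exists r.
have Tt : T t by exists r => //; exists s.
by exists s => //; exists t.
Qed.

(** * Six distinct preimages outside finitely many [c] *)

Lemma preimage_quad a c x y : preimages a c y -> quad c x = y -> preimages a c x.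
Proof. by move=> [N _ <-] <-; exists N.+1; rewrite // iterSr. Qed.

Lemma uniq_opp3 r s t :
  r ^+ 2 != 0 -> s ^+ 2 != 0 -> t ^+ 2 != 0 ->
  r ^+ 2 != s ^+ 2 -> s ^+ 2 != t ^+ 2 -> r ^+ 2 != t ^+ 2 ->
  uniq [:: r; - r; s; - s; t; - t].
Proof.
have sqr_neq (x y : K) : x ^+ 2 != y ^+ 2 ->
    [/\ x != y, x != - y, - x != y & - x != - y].
  rewrite eqf_sqr negb_or => /andP[xy xNy].
  by rewrite xy xNy eqr_opp xy eqr_oppLR xNy.
have opp_neq (x : K) : x ^+ 2 != 0 -> x != - x.
  rewrite sqrf_eq0 -addr_eq0 -mulr2n -mulr_natl => x0.
  by rewrite mulf_neq0 ?pchar0_two_neq0.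
move=> /opp_neq r0 /opp_neq s0 /opp_neq t0.
move=> /sqr_neq[? ? ? ?] /sqr_neq[? ? ? ?] /sqr_neq[? ? ? ?].
by rewrite /= !inE !negb_or; do !(apply/andP; split).
Qed.

(* The factors correspond to [r = 0], to [r ^+ 2 = s ^+ 2] or [s ^+ 2 = t ^+ 2]
   (both amount to [r = a]), and to [s = 0], [t = 0], [r ^+ 2 = t ^+ 2]. *)
Definition collisions a : {poly K} :=
  ('X - a%:P) * ('X - (a - a ^+ 2)%:P) * ('X^2 + 'X - a%:P)
  * ('X^4 + 'X^3 *+ 2 + 'X^2 + 'X - a%:P)
  * ('X^2 + (a ^+ 2 *+ 2 + 1) *: 'X + (a ^+ 4 - a)%:P).

Lemma collisions_neq0 a : collisions a != 0.
Proof.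
rewrite !mulf_neq0 ?polyXsubC_eq0 //.
- apply/eqP => /(congr1 (coefp 2)) /eqP.
  by rewrite /coefp !coefE /= subr0 addr0 oner_eq0.
- apply/eqP => /(congr1 (coefp 4)) /eqP.
  by rewrite /coefp !coefE /= mul0rn subr0 !addr0 oner_eq0.
- apply/eqP => /(congr1 (coefp 2)) /eqP.
  by rewrite /coefp !coefE /= mulr0 !addr0 oner_eq0.
Qed.

Lemma six_preimages a c r s t : ~~ root (collisions a) c ->
  r ^+ 2 = a - c -> s ^+ 2 = r - c -> t ^+ 2 = s - c ->
  uniq [:: r; - r; s; - s; t; - t] /\
  {in [:: r; - r; s; - s; t; - t], forall x, preimages a c x}.
Proof.
rewrite /collisions !rootM !negb_or !rootE -!andbA.
rewrite !(hornerD, hornerN, hornerC, hornerX, hornerXn, hornerZ, hornerMn).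
move=> /and5P[c1 c2 c3 c4 c5] Dr Ds Dt; split.
  have ra : r != a.
    apply: contra c2 => /eqP ra; rewrite ra in Dr.
    by rewrite Dr; apply/eqP; ring.
  have sa : s != a.
    apply: contra c5 => /eqP sa; rewrite sa in Ds.
    have Er : r = a ^+ 2 + c by rewrite Ds subrK.
    rewrite Er in Dr; apply/eqP.
    transitivity ((a ^+ 2 + c) ^+ 2 - a + c); first by ring.
    by rewrite Dr; ring.
  have rs : r != s.
    apply: contra ra => /eqP rs; apply/eqP/(addIr (- c)).
    by rewrite -Dr -Ds rs.
  have r0 : a - c != 0 by rewrite -oppr_eq0 opprB.
  have s0 : r - c != 0.
    apply: contra c3; rewrite subr_eq0 => /eqP rc.
    by rewrite -rc Dr rc; apply/eqP; ring.
  have t0 : s - c != 0.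
    apply: contra c4; rewrite subr_eq0 => /eqP sc.
    have Er : r = c ^+ 2 + c by rewrite -{1}sc Ds subrK.
    rewrite Er in Dr; apply/eqP.
    transitivity ((c ^+ 2 + c) ^+ 2 + c - a); first by ring.
    by rewrite Dr; ring.
  (* The three squares are [a - c], [r - c] and [s - c], so they differ as soon as [a], [r] and [s]
     do. *)
  by apply: uniq_opp3; rewrite ?Dr ?Ds ?Dt ?(inj_eq (addIr _)) // eq_sym.
have Pr : quad c r = a by rewrite /quad Dr subrK.
have Ps : quad c s = r by rewrite /quad Ds subrK.
have Pt : quad c t = s by rewrite /quad Dt subrK.
have QN x : quad c (- x) = quad c x by rewrite /quad sqrrN.
have inP x : quad c x = a -> preimages a c x by exists 1%N.
have inPr : preimages a c r by exact: inP.
have inPs : preimages a c s by exact: preimage_quad Ps.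
move=> x; rewrite !inE => /or4P[/eqP->|/eqP->|/eqP->|/or3P[]/eqP->] //.
- by apply: inP; rewrite QN.
- by apply: preimage_quad inPr _; rewrite QN.
- exact: preimage_quad Pt.
- by apply: preimage_quad inPs _; rewrite QN.
Qed.

Lemma cofinite_six_preimages a F : finite_set F ->
  exists c l, [/\ ~ F c, uniq l, size l = 6%N &
    {in l, forall x, preimages a c x}].
Proof.
move=> finF.
pose G := F `|` [set c | root (collisions a) c].
have finG : finite_set G.
  by rewrite /G finite_setU; split; [|exact/finite_root/collisions_neq0].
(* The four removed values are the solutions of [X = - (4 * a)], [X ^+ 2 = 1] and
   [(2 - X) ^+ 2 = 1]. *)
have := infinite_setD (infinite_setD (@infinite_cubic_abscissas (4 * a + 1))
  (finite_abscissas a finG)) (finite_set4 (- (4 * a)) 1 (-1) 3).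
move=> /infinite_setN0[X [[[n Dn] nT] nE]].
have [|||r [s [t [Ds Dt DX]]]] := cubic_point_preimages Dn.
- by apply/eqP => XE; apply: nE; do 3!left.
- apply/negP; rewrite sqrf_eq1 => /orP[] /eqP XE; apply: nE.
    by left; left; right.
  by left; right.
- apply/negP; rewrite sqrf_eq1 => /orP[] /eqP XE; apply: nE.
    by left; left; right; apply: (@subrI _ 2) => /=; rewrite XE; ring.
  by right; apply: (@subrI _ 2) => /=; rewrite XE; ring.
have nG : ~ G (a - r ^+ 2) by move=> Gc; apply: nT; exists r, s, t.
have [|||| uniq_l sub_l] := @six_preimages a (a - r ^+ 2) r s t.
- by apply/negP => ac; apply: nG; right.
- by rewrite subKr.
- by rewrite Ds; ring.
- by rewrite Dt; ring.
exists (a - r ^+ 2), [:: r; - r; s; - s; t; - t]; split=> //.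
by move=> Fc; apply: nG; left.
Qed.
End Preimages.

Theorem theorem3p1 (R : realType) (K : fieldExtType rat) :
  exists S : set K, finite_set S /\
    (forall a : K, ~ S a -> (6%:R%:E <= kappa_bar R a)%E) /\
    (forall a : K, S a -> kappa_bar R a = 4%:R%:E).
Proof.
exists (@set0 K); split; first exact: finite_set0.
split=> // a _.
(* For each finite [F], a single [c] outside it with six preimages bounds the supremum below. *)
apply: le_ereal_inf_tmp => _ [F finF <-].
have charK : [pchar K]%R =i pred0.
  by move=> p; rewrite pchar_lalg Num.Theory.pchar_num.
have [c [l [nFc uniq_l size_l sub_l]]] := cofinite_six_preimages charK a finF.
apply: (@Order.POrderTheory.le_trans _ _ (counting (preimages a c)));
  last first.
  by apply: ereal_sup_ubound; exists c.
rewrite /counting; case: asboolP => [finP|_]; last by rewrite leey.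
rewrite lee_fin Num.Theory.ler_nat -size_l uniq_leq_size // => x xl.
by rewrite in_fset_set // inE; exact: sub_l.
Qed.
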